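(* Consider the system $$\frac{d\theta[\boldsymbol\gamma]}{dt} = f(\theta[\boldsymbol\gamma],t) + B(t)\,\tilde u$$ for the turning angle $\theta[\boldsymbol\gamma]$ of the projected kite trajectory $\boldsymbol\gamma=\mathbf{r}/\|\mathbf{r}\|$, the control law $$\tilde u := -\frac{1}{\sum_i \lambda_i \hat{\mathbf{w}}_i\cdot\mathbf{b}}\left[\left.\frac{d\theta[\boldsymbol\gamma]}{dt}\right|_{u^*} - \frac{d\theta_t}{dt} + K e\right],\qquad e:=\theta[\boldsymbol\gamma]-\theta_t,\quad K>0,$$ and the estimator update laws $$\frac{d\hat{\mathbf{w}}_i}{dt} := \Gamma\, e_m\,\lambda_i\,\tilde u_a\,\mathbf{b},\qquad i\in\{x,y,z\},\quad \Gamma>0,$$ in the case that the actuated increment equals the commanded one, $\tilde u_a=\tilde u$. Assume that there is a $t_0>0$ such that for all $t>t_0$ $$\|\dot{\boldsymbol\gamma}(t)\|>0$$ holds, so that for $t>t_0$ the kite trajectory is a regular curve. Additionally assume that for all $t>t_0$ the geometric condition $$\left.\frac{d\ddot{\boldsymbol\gamma}}{du}\right|_t\not\parallel \mathbf{r}(t),$$ i.e. that the given two vectors are not parallel, is satisfied, so that the control law is well-defined. Finally, assume that for some $M\in\mathbb{R}^+$ and for all $t>0$ the bounds $$\left|\left.\frac{d\theta[\boldsymbol\gamma]}{dt}\right|_t\right|\le M,\qquad \left|\left.\frac{d\theta_t}{dt}\right|_t\right|\le M,\qquad |\theta[\boldsymbol\gamma](t)-\theta_t(t)|\le M$$ hold.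 Then, for any initial condition and for any reference trajectory, the turning angle of the kite trajectory converges to the target: $$\lim_{t\to\infty}\big(\theta[\boldsymbol\gamma](t)-\theta_t(t)\big)=0.$$
   Context: $\mathbf{r}(t)\in\mathbb{R}^3$ is the vector from the earth tether attachment point to the kite, $r=\|\mathbf{r}\|$, and $\boldsymbol\gamma=\mathbf{r}/r$ is its projection on the upper half of the unit sphere. For the point $(\cos\psi\cos\varphi,\cos\psi\sin\varphi,\sin\psi)$ of the sphere, the tangent plane has the orthonormal basis $\mathbf{e}_1=(-\sin\varphi,\cos\varphi,0)$, $\mathbf{e}_2=(-\cos\varphi\sin\psi,-\sin\varphi\sin\psi,\cos\psi)$. The turning angle $\theta[\boldsymbol\gamma]$ is the continuous (not restricted to $[-\pi,\pi]$) angle with $\dot{\boldsymbol\gamma}=\|\dot{\boldsymbol\gamma}\|(\cos\theta[\boldsymbol\gamma]\,\mathbf{e}_1+\sin\theta[\boldsymbol\gamma]\,\mathbf{e}_2)$, and $\theta_t(t)$ is the target turning angle. $u$ is the steering input, $u^*$ its current value, $\tilde u=u-u^*$ the commanded increment, and $\tilde u_a$ the increment implemented by the actuator. The acceleration $\ddot{\boldsymbol\gamma}$ is assumed locally affine in $\tilde u$. With $\dot x,\dot y,\ddot x,\ddot y$ the coordinates of velocity and acceleration of the projected trajectory in the basis $(\mathbf{e}_1,\mathbf{e}_2)$ and $\mathbf{e}_z$ the earth vertical unit vector, $$f=\left.\frac{d\theta[\boldsymbol\gamma]}{dt}\right|_{u^*}=\frac{\dot x\ddot y-\ddot x\dot y}{\|\dot{\boldsymbol\gamma}\|^2}-(\boldsymbol\gamma\cdot\mathbf{e}_z)\cos\theta[\boldsymbol\gamma]\,\|\dot{\boldsymbol\gamma}\|,\qquad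 B=\frac{\dot x\frac{\partial\ddot y}{\partial u}-\frac{\partial\ddot x}{\partial u}\dot y}{\|\dot{\boldsymbol\gamma}\|^2}.$$ All measured quantities enter through the time-dependence of $f$ and $B$. $B$ is linear in the control derivatives $C_{i,u}=\mathbf{w}_i\cdot\mathbf{b}$, $i\in\{x,y,z\}$ (dimensionless sensitivities of the aerodynamic force to $u$ in a body-fixed frame, functions of $u$, represented by B-spline networks): $B=\sum_i\lambda_i\,\mathbf{w}_i\cdot\mathbf{b}$ with coefficients $\lambda_i(t)\in\mathbb{R}$, vector $\mathbf{b}$ of B-spline basis functions, and true weights $\mathbf{w}_i$ (constant in time). $\hat{\mathbf{w}}_i(t)$ is the estimate of $\mathbf{w}_i$. The modified tracking error is $e_m:=e-\zeta$, where $$\frac{d\zeta}{dt}:=-K\zeta+\Big(\sum_i\lambda_i\hat{\mathbf{w}}_i\cdot\mathbf{b}\Big)(\tilde u_a-\tilde u).$$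
   Formalization: The estimated gain (sum of lambda_i w-hat_i . b) is assumed nonzero for all t > t_0, since the geometric condition does not constrain the estimates and so does not make the control law well-defined. *)

(* Defs.v *)
From HB Require Import structures.
From mathcomp Require Import all_boot all_order all_algebra.
From mathcomp Require Import all_classical all_reals all_analysis.

Set Implicit Arguments.
Unset Strict Implicit.
Unset Printing Implicit Defensive.

Import Order.TTheory GRing.Theory Num.Theory.
Import numFieldNormedType.Exports.

Local Open Scope classical_set_scope.
Local Open Scope ring_scope.

Definition dot (R : realType) (n : nat) (u v : 'rV[R]_n) : R :=
  \sum_(i < n) u 0 i * v 0 i.

(* The library norm on 'rV[R]_n is the sup norm. *)
Definition enorm (R : realType) (n : nat) (u : 'rV[R]_n) : R :=
  Num.sqrt (dot u u).

(* Linear dependence: the zero vector is parallel to every vector. *)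
Definition parallel (R : realType) (n : nat) (u v : 'rV[R]_n) : Prop :=
  exists a b : R, (a, b) != (0, 0) /\ a *: u + b *: v = 0.

Definition vec3 (R : realType) (a b c : R) : 'rV[R]_3 :=
  \row_(i < 3) [:: a; b; c]`_i.

Definition e_z (R : realType) : 'rV[R]_3 := vec3 0 0 1.

Definition sphere_point (R : realType) (phi psi : R) : 'rV[R]_3 :=
  vec3 (cos psi * cos phi) (cos psi * sin phi) (sin psi).

Definition e_1 (R : realType) (phi : R) : 'rV[R]_3 :=
  vec3 (- sin phi) (cos phi) 0.

Definition e_2 (R : realType) (phi psi : R) : 'rV[R]_3 :=
  vec3 (- (cos phi * sin psi)) (- (sin phi * sin psi)) (cos psi).

Definition projected (R : realType) (r : R -> 'rV[R]_3) (t : R) : 'rV[R]_3 :=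
  (enorm (r t))^-1 *: r t.

(* (phi t, psi t) are the spherical coordinates of g t, on the upper half of
   the unit sphere. At the zenith phi t, hence (e_1, e_2), is arbitrary. *)
Definition upper_half_coordinates (R : realType) (g : R -> 'rV[R]_3)
    (phi psi : R -> R) (t : R) : Prop :=
  [/\ 0 <= psi t, psi t <= pi / 2 & g t = sphere_point (phi t) (psi t)].

Definition turning_angle_at (R : realType) (g : R -> 'rV[R]_3)
    (phi psi theta : R -> R) (t : R) : Prop :=
  {for t, continuous theta} /\
  derive1 g t = enorm (derive1 g t) *:
    (cos (theta t) *: e_1 (phi t) + sin (theta t) *: e_2 (phi t) (psi t)).

Section TurningDynamics.
Variables (R : realType) (g : R -> 'rV[R]_3) (phi psi : R -> R).
(* acc t u : acceleration of the projected trajectory at time t as a function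
   of the steering input u; ustar t : current value of the input.
   acc is not tied to the second derivative of g. If it were, differentiating
   the turning angle would yield the connection term tan psi cos theta ||g'||,
   whereas drift has (g . e_z) = sin psi in place of tan psi; both together
   with theta' = f + B * utilde would force psi = 0 or cos theta = 0. *)
Variables (acc : R -> R -> 'rV[R]_3) (ustar : R -> R).

Definition xdot t := dot (derive1 g t) (e_1 (phi t)).
Definition ydot t := dot (derive1 g t) (e_2 (phi t) (psi t)).
Definition xddot t u := dot (acc t u) (e_1 (phi t)).
Definition yddot t u := dot (acc t u) (e_2 (phi t) (psi t)).

(* f(theta, t) = d theta / dt at u = ustar. *)
Definition drift (th t : R) : R :=
  (xdot t * yddot t (ustar t) - xddot t (ustar t) * ydot t)
    / enorm (derive1 g t) ^+ 2
  - dot (g t) (e_z R) * cos th * enorm (derive1 g t).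

Definition input_gain (t : R) : R :=
  (xdot t * derive1 (yddot t) (ustar t) - derive1 (xddot t) (ustar t) * ydot t)
    / enorm (derive1 g t) ^+ 2.

Definition locally_affine_at (t : R) : Prop :=
  exists a : 'rV[R]_3,
    \forall v \near (0 : R), acc t (ustar t + v) = acc t (ustar t) + v *: a.

End TurningDynamics.

(* Cox-de Boor recursion for the j-th B-spline of degree p on the given knots;
   0 / 0 = 0 handles repeated knots as usual. *)
Fixpoint bspline (R : realType) (knot : nat -> R) (p j : nat) (u : R) : R :=
  match p with
  | 0 => if (knot j <= u) && (u < knot j.+1) then 1 else 0
  | q.+1 =>
      (u - knot j) / (knot (j + q.+1)%N - knot j) * bspline knot q j u
      + (knot (j + q.+2)%N - u) / (knot (j + q.+2)%N - knot j.+1)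
        * bspline knot q j.+1 u
  end.

Definition bspline_basis (R : realType) (n : nat) (knot : nat -> R) (p : nat)
    (u : R) : 'rV[R]_n :=
  \row_(j < n) bspline knot p j u.

(* sum_i lambda_i (w_i . b), with 'I_3 for {x, y, z}. *)
Definition network_gain (R : realType) (n : nat) (lambda : 'I_3 -> R)
    (w : 'I_3 -> 'rV[R]_n) (b : 'rV[R]_n) : R :=
  \sum_(i < 3) lambda i * dot (w i) b.

(* Main.v *)
(**
   Along the closed loop with [utilde_a = utilde], the error satisfies
   [e' = - K e + (B - Bhat) utilde], and [zeta' = - K zeta]; hence
   [e_m' = - K e_m + (B - Bhat) utilde].  The update laws are chosen so that
   the weight errors cancel the unknown term in the derivative of
   [V = (e_m^2 + Gamma^-1 * sum_i |what_i - w_i|^2) / 2], leaving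
   [V' = - K e_m^2].  As [e_m'] is bounded, a Barbalat argument gives
   [e_m --> 0].  The same argument with [zeta^2 / 2] gives [zeta --> 0].
*)
Require Import Defs.
From HB Require Import structures.
From mathcomp Require Import all_boot all_order all_algebra.
From mathcomp Require Import all_classical all_reals all_analysis.
From mathcomp Require Import ring lra.

Set Implicit Arguments.
Unset Strict Implicit.
Unset Printing Implicit Defensive.

Import Order.TTheory GRing.Theory Num.Theory.
Import numFieldNormedType.Exports.

Local Open Scope classical_set_scope.
Local Open Scope ring_scope.

Lemma is_derive_mx_coord (R : realType) (m n : nat) (u : R -> 'M[R]_(m, n))
    (du : 'M[R]_(m, n)) (t : R) (i : 'I_m) (j : 'I_n) :
  is_derive t 1 u du -> is_derive t 1 (fun s => u s i j) (du i j).
Proof.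
move=> [u_t <-]; rewrite derive_mx// mxE; split=> //.
exact: (derivable_mxP u t 1).1.
Qed.

Lemma is_derive_sqr (R : realType) (g : R -> R) (dg t : R) :
  is_derive t 1 g dg -> is_derive t 1 (fun s => g s ^+ 2) (2 * g t * dg).
Proof. by move=> g_t; exact: (is_deriveX 2 g_t). Qed.

Lemma is_derive_dot_self (R : realType) (n : nat) (u : R -> 'rV[R]_n)
    (c du : 'rV[R]_n) (t : R) :
  is_derive t 1 u du ->
  is_derive t 1 (fun s => dot (u s - c) (u s - c)) (2 * dot (u t - c) du).
Proof.
move=> u_t; rewrite (_ : (fun s => _) =
    \sum_(j < n) (fun s => (u s 0 j - c 0 j) ^+ 2)); last first.
  apply/funext => s; rewrite fct_sumE; apply: eq_bigr => j _.
  by rewrite !mxE expr2.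
rewrite /dot mulr_sumr.
apply: is_derive_sum => j; rewrite !mxE mulrA; apply: is_derive_sqr.
rewrite -[du 0 j]subr0.
exact: (is_deriveB (is_derive_mx_coord 0 j u_t) (is_derive_cst (c 0 j) t 1)).
Qed.

Lemma dot_self_ge0 (R : realType) (n : nat) (u : 'rV[R]_n) : 0 <= dot u u.
Proof. by apply: sumr_ge0 => j _; rewrite -expr2 sqr_ge0. Qed.

Lemma network_gainB (R : realType) (n : nat) (lambda : 'I_3 -> R)
    (v w : 'I_3 -> 'rV[R]_n) (b : 'rV[R]_n) :
  network_gain lambda (fun i => v i - w i) b =
  network_gain lambda v b - network_gain lambda w b.
Proof.
rewrite /network_gain -sumrB; apply: eq_bigr => i _.
rewrite -mulrBr; congr (_ * _); rewrite /dot -sumrB.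
by apply: eq_bigr => j _; rewrite !mxE mulrBl.
Qed.

Lemma MVT_ray (R : realType) (f df : R -> R) (a : R) :
  (forall t, a < t -> is_derive t 1 f (df t)) ->
  forall s t, a < s -> s <= t ->
  exists2 c, s <= c <= t & f t - f s = df c * (t - s).
Proof.
move=> f_t s t a_s s_t; have [||c c_st ->] := @MVT_segment R f df s t s_t.
- by move=> x /[!in_itv]/= /andP[s_x _]; apply: f_t; exact: lt_trans s_x.
- apply: derivable_within_continuous => x /[!in_itv]/= /andP[s_x _].
  by have [] := f_t x (lt_le_trans a_s s_x).
- by exists c => //; move: c_st; rewrite in_itv.
Qed.

(** [V] is nonincreasing and bounded below, so it cannot keep losing a fixed amount. A late time
    with [g] of size at least [eps] would cost such an amount, because the bound on [dg] keeps [g]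
    away from 0 for a while afterwards. *)
Lemma barbalat_lyapunov (R : realType) (V g dg : R -> R) (a K L : R) :
  0 < K ->
  (forall t, a < t -> 0 <= V t) ->
  (forall t, a < t -> is_derive t 1 V (- K * g t ^+ 2)) ->
  (forall t, a < t -> is_derive t 1 g (dg t)) ->
  (forall t, a < t -> `|dg t| <= L) ->
  g t @[t --> +oo] --> (0 : R).
Proof.
move=> K_gt0 V_ge0 V_t g_t dg_le.
(* [L] may be 0; the added 1 makes the division by [L'] legitimate. *)
pose L' : R := `|L| + 1.
have L'_gt0 : 0 < L' by rewrite ltr_wpDl.
have dg_le' t : a < t -> `|dg t| <= L'.
  by move=> /dg_le /le_trans; apply; rewrite ler_wpDr// ler_norm.
have V_anti s t : a < s -> s <= t -> V t <= V s.
  move=> a_s s_t; have [c _ Vts] := MVT_ray V_t a_s s_t.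
  by rewrite -subr_le0 Vts !mulNr oppr_le0 mulr_ge0 ?subr_ge0// mulr_ge0 ?sqr_ge0// ltW.
apply/cvgr0Pnorm_lt => eps eps_gt0.
(* Within time [delta], [g] moves by at most [eps / 2]; if [g] starts with size at least [eps], then
   [V] drops by at least [eta] meanwhile. *)
pose delta := eps / (2 * L').
have delta_gt0 : 0 < delta by rewrite divr_gt0// mulr_gt0.
have L'delta : L' * delta = eps / 2 by rewrite /delta; field; rewrite gt_eqF.
pose eta := K * (eps / 2) ^+ 2 * delta.
have eta_gt0 : 0 < eta by rewrite mulr_gt0// mulr_gt0// exprn_gt0// divr_gt0.
pose E := V @` [set t | a < t].
have E_lb : has_lbound E by exists 0 => _ [t a_t <-]; exact: V_ge0.
have E_inf : has_inf E.
  by split=> //; exists (V (a + 1)); exists (a + 1) => //=; rewrite ltrDl.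
(* After [s] a drop by [eta] would take [V] below its infimum. *)
have [_ [s /= a_s <-] Vs] := inf_adherent eta_gt0 E_inf.
exists s; split; first exact: num_real.
move=> t s_t; rewrite ltNge; apply/negP => gt_ge.
have a_t : a < t by exact: lt_trans s_t.
have t_td : t <= t + delta by rewrite lerDl ltW.
have [c /andP[t_c c_td] dV] := MVT_ray V_t a_t t_td.
have [d /andP[t_d _] dg_ct] := MVT_ray g_t a_t t_c.
have gct : `|g c - g t| <= eps / 2.
  rewrite dg_ct normrM -L'delta ler_pM//.
    by apply: dg_le'; exact: lt_le_trans t_d.
  by rewrite ger0_norm ?subr_ge0// lerBlDl.
have gc : eps / 2 <= `|g c|.
  have := lerB_dist (g t) (g t - g c); rewrite subKr distrC.
  by move: gct gt_ge; lra.
have eta_le : V (t + delta) <= V t - eta.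
  have : (eps / 2) ^+ 2 <= g c ^+ 2.
    by rewrite -[leRHS]real_normK ?num_real// lerXn2r// nnegrE// divr_ge0// ltW.
  move=> /(ler_wpM2l (ltW K_gt0)) /(ler_wpM2r (ltW delta_gt0)).
  by move: dV; rewrite -/eta addrAC subrr add0r; lra.
have := V_anti _ _ a_s (ltW s_t).
have : inf E <= V (t + delta).
  by apply: ge_inf => //; exists (t + delta) => //=; exact: lt_le_trans t_td.
by move: Vs eta_le; lra.
Qed.

(** The derivative of [z ^+ 2] is [- 2 * K * z ^+ 2], which is nonpositive. This supplies the bound
    on [zeta'] that the Barbalat argument needs. *)
Lemma linear_decay_norm_le (R : realType) (z : R -> R) (a K : R) :
  0 <= K ->
  (forall t, a < t -> is_derive t 1 z (- K * z t)) ->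
  forall s t, a < s -> s <= t -> `|z t| <= `|z s|.
Proof.
move=> K_ge0 z_t s t a_s s_t.
have [c _ ] := MVT_ray (fun t a_t => is_derive_sqr (z_t t a_t)) a_s s_t.
rewrite -ler_sqr ?nnegrE// !real_normK ?num_real// -subr_le0 => ->.
have -> : 2 * z c * (- K * z c) * (t - s) = - (2 * K * z c ^+ 2 * (t - s)).
  by ring.
by rewrite oppr_le0 mulr_ge0 ?subr_ge0// mulr_ge0 ?sqr_ge0// mulr_ge0.
Qed.

Theorem theorem4p1 (R : realType)
  (* kite trajectory, its projection in spherical coordinates, turning angle *)
  (r : R -> 'rV[R]_3) (phi psi theta : R -> R)
  (* target turning angle *)
  (theta_t : R -> R)
  (* steering input: current value, commanded and actuated increments *)
  (ustar utilde utilde_a : R -> R)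
  (* acceleration of the projected trajectory: time, steering input *)
  (acc : R -> R -> 'rV[R]_3)
  (* B-spline networks: number of weights, degree, knots *)
  (n p : nat) (knot : nat -> R)
  (lambda : 'I_3 -> R -> R)
  (w : 'I_3 -> 'rV[R]_n) (what : 'I_3 -> R -> 'rV[R]_n)
  (zeta : R -> R) (K Gamma t0 M : R) :
  let gamma := projected r in
  let b t := bspline_basis n knot p (ustar t) in
  let f := drift gamma phi psi acc ustar in
  let B := input_gain gamma phi psi acc ustar in
  let Bhat t := network_gain (lambda^~ t) (what^~ t) (b t) in
  let e t := theta t - theta_t t in
  let e_m t := e t - zeta t in
  0 < K -> 0 < Gamma -> 0 < t0 -> 0 < M ->
  {homo knot : i j / (i <= j)%N >-> i <= j} ->
  (* kinematics *)
  (forall t, 0 < t -> r t != 0) ->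
  (forall t, 0 < t -> derivable gamma t 1) ->
  (forall t, 0 < t -> upper_half_coordinates gamma phi psi t) ->
  (forall t, 0 < t -> turning_angle_at gamma phi psi theta t) ->
  (* the acceleration is locally affine in the increment *)
  (forall t, t0 < t -> locally_affine_at acc ustar t) ->
  (* the true input gain is represented by the networks *)
  (forall t, t0 < t -> B t = network_gain (lambda^~ t) w (b t)) ->
  (* system *)
  (forall t, t0 < t ->
     is_derive t 1 theta (f (theta t) t + B t * utilde t)) ->
  (* control law, which is defined *)
  (forall t, t0 < t -> Bhat t != 0) ->
  (forall t, t0 < t ->
     utilde t =
       - (1 / Bhat t) * (f (theta t) t - derive1 theta_t t + K * e t)) ->
  (* estimator update laws *)
  (forall i t, t0 < t ->
     is_derive t 1 (what i)
       ((Gamma * e_m t * lambda i t * utilde_a t) *: b t)) ->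
  (* modification of the tracking error *)
  (forall t, t0 < t ->
     is_derive t 1 zeta
       (- K * zeta t + Bhat t * (utilde_a t - utilde t))) ->
  (* the actuated increment equals the commanded one *)
  (forall t, t0 < t -> utilde_a t = utilde t) ->
  (* regular curve *)
  (forall t, t0 < t -> 0 < enorm (derive1 gamma t)) ->
  (* geometric condition *)
  (forall t, t0 < t -> ~ parallel (derive1 (acc t) (ustar t)) (r t)) ->
  (* bounds *)
  (forall t, 0 < t -> derivable theta t 1 /\ `|derive1 theta t| <= M) ->
  (forall t, 0 < t -> derivable theta_t t 1 /\ `|derive1 theta_t t| <= M) ->
  (forall t, 0 < t -> `|theta t - theta_t t| <= M) ->
  (theta t - theta_t t) @[t --> +oo] --> (0 : R).
Proof.
move=> gamma b f B Bhat e e_m K_gt0 Gamma_gt0 t0_gt0 M_gt0 _ _ _ _ _ _ B_E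
  theta_dyn Bhat_neq0 utilde_E what_t zeta_t utilde_aE _ _ theta_M theta_tM _.
have zeta_decay t : t0 < t -> is_derive t 1 zeta (- K * zeta t).
  move=> t_gt; apply: is_derive_eq (zeta_t t t_gt) _.
  by rewrite utilde_aE// subrr mulr0 addr0.
(* [zeta] is controlled only on the open ray beyond [t0], so its norm is compared with its value at
   an interior point. *)
pose t1 := t0 + 1.
have t0_t1 : t0 < t1 by rewrite ltrDl.
have t1_gt t : t1 < t -> t0 < t by exact: lt_trans.
have t1_pos t : t1 < t -> 0 < t by move/t1_gt; exact: lt_trans.
have zeta_le t : t1 < t -> `|- K * zeta t| <= K * `|zeta t1|.
  move=> /ltW t_ge; rewrite normrM normrN (gtr0_norm K_gt0) ler_pM2l//.
  exact: (linear_decay_norm_le (ltW K_gt0) zeta_decay).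
have e_t t : t1 < t ->
    is_derive t 1 e (derive1 theta t - derive1 theta_t t).
  move=> /t1_pos t_gt0; have [[? _] [? _]] := (theta_M t t_gt0, theta_tM t t_gt0).
  by rewrite !derive1E; apply: (is_deriveB (derivableP _) (derivableP _)).
have em_t t : t1 < t -> is_derive t 1 e_m
    (derive1 theta t - derive1 theta_t t - - K * zeta t).
  by move=> t_gt; exact: (is_deriveB (e_t t t_gt) (zeta_decay t (t1_gt t t_gt))).
(* The left side is bounded by the hypotheses; the right side is the form suited to [V']. The
   control law enters as a formula for [Bhat t * utilde t], with [B] split as
   [Bhat + (B - Bhat)]. *)
have em_dyn t : t1 < t ->
    derive1 theta t - derive1 theta_t t - - K * zeta t =
    - K * e_m t + (B t - Bhat t) * utilde t.
  move=> /t1_gt t_gt; have [_] := theta_dyn t t_gt; rewrite -derive1E => ->.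
  have : Bhat t * utilde t = - (f (theta t) t - derive1 theta_t t + K * e t).
    by rewrite utilde_E// div1r mulNr mulrN mulVKf// Bhat_neq0.
  by rewrite /e_m; move: (f _ _) => F; lra.
pose V t := 2^-1 * e_m t ^+ 2 +
  (2 * Gamma)^-1 * \sum_(i < 3) dot (what i t - w i) (what i t - w i).
have V_ge0 t : t1 < t -> 0 <= V t.
  move=> _; rewrite addr_ge0// mulr_ge0 ?invr_ge0 ?sqr_ge0//.
    by rewrite mulr_ge0// ltW.
  by apply: sumr_ge0 => i _; exact: dot_self_ge0.
have V_t t : t1 < t -> is_derive t 1 V (- K * e_m t ^+ 2).
  move=> t_gt; have t_gt0 := t1_gt _ t_gt.
  have weights_t := is_derive_sum
    (fun i => is_derive_dot_self (w i) (what_t i t t_gt0)).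
  have := is_deriveD (is_deriveZ 2^-1 (is_derive_sqr (em_t t t_gt)))
    (is_deriveZ (2 * Gamma)^-1 weights_t).
  rewrite em_dyn//.
  set dV := (X in is_derive _ _ _ X) => V_t.
  have -> : - K * e_m t ^+ 2 = dV.
    rewrite /dV.
    under eq_bigr do rewrite utilde_aE//.
    (* After division by [2 * Gamma] this is the opposite of the cross term
       [e_m * (B - Bhat) * utilde] from [e_m ^+ 2 / 2]. *)
    have -> : \sum_(i < 3) 2 * dot (what i t - w i)
        ((Gamma * e_m t * lambda i t * utilde t) *: b t) =
        2 * Gamma * e_m t * utilde t * (Bhat t - B t).
      rewrite B_E// -network_gainB mulr_sumr; apply: eq_bigr => i _.
      rewrite /dot !mulr_sumr; apply: eq_bigr => j _; rewrite !mxE; ring.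
    by rewrite /GRing.scale/=; field; rewrite gt_eqF.
  congr (is_derive t 1 _ _): V_t; apply/funext => s.
  by rewrite [LHS]/GRing.add/= fct_sumE.
have em_cvg : e_m t @[t --> +oo] --> (0 : R).
  apply: (barbalat_lyapunov (L := M + M + K * `|zeta t1|) K_gt0 V_ge0 V_t em_t).
  move=> t t_gt; have t_gt0 := t1_pos _ t_gt.
  rewrite (le_trans (ler_normB _ _))// lerD ?zeta_le//.
  rewrite (le_trans (ler_normB _ _))// lerD//.
    by have [] := theta_M t t_gt0.
  by have [] := theta_tM t t_gt0.
have zeta_cvg : zeta t @[t --> +oo] --> (0 : R).
  apply: (barbalat_lyapunov (V := fun t => 2^-1 * zeta t ^+ 2) K_gt0 _ _
    (fun t t_gt => zeta_decay t (t1_gt t t_gt)) zeta_le).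
  - by move=> t _; rewrite mulr_ge0// ?invr_ge0// sqr_ge0.
  - move=> t /t1_gt t_gt.
    have := is_deriveZ 2^-1 (is_derive_sqr (zeta_decay t t_gt)).
    by move/is_derive_eq; apply; rewrite /GRing.scale/=; field.
rewrite -[0]addr0 (_ : (fun t => _) = e_m \+ zeta); first exact: cvgD.
by apply/funext => t; rewrite /e_m /e /= subrK.
Qed.
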